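(* Let $\mathbb{B}$ be an infinite complete Boolean algebra, and suppose there exists an antichain $A$ in $\mathbb{B}$ with $2^{|A|}=|\mathbb{B}|$. Then there exist two Tukey-maximal ultrafilters $U$ and $V$ on $\mathbb{B}$ such that $U\not\le_\mathrm{JPR}V$ and $V\not\le_\mathrm{JPR}U$. (In particular $U$ and $V$ are Tukey-equivalent but JPR-incomparable.)
   Context: $\mathrm{Part}(\mathbb{B})$ denotes the set of maximal antichains of $\mathbb{B}$; $B$ refines $A$ if every element of $B$ lies below some element of $A$. JPR-ordering: for ultrafilters $U,V$ on a complete Boolean algebra $\mathbb{B}$, $U\le_\mathrm{JPR}V$ iff there exist $g\colon\mathrm{Part}(\mathbb{B})\to\mathrm{Part}(\mathbb{B})$ and, for each $A\in\mathrm{Part}(\mathbb{B})$, a function $f_A\colon g(A)\to A$ such that (1) for all $A\in\mathrm{Part}(\mathbb{B})$ and $X\subseteq A$: $\bigvee X\in U\iff\bigvee f_A^{-1}[X]\in V$; (2) whenever $B$ refines $A$ (both in $\mathrm{Part}(\mathbb{B})$), $\bigvee\{a\wedge b: a\in g(A), b\in g(B), f_B(b)\le f_A(a)\}\in V$. Tukey reducibility: $\langle U,\ge\rangle\le_\mathrm{T}\langle V,\ge\rangle$ iff there exist $f\colon U\to V$ and $g\colon V\to U$ with $v\le f(u)\Rightarrow g(v)\le u$ for all $u\in U,v\in V$. An ultrafilter $V$ on $\mathbb{B}$ is Tukey-maximal if $\langle U,\ge\rangle\le_\mathrm{T}\langle V,\ge\rangle$ for every ultrafilter $U$ on $\mathbb{B}$.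 *)

(* Defs.v *)
From HB Require Import structures.
From mathcomp Require Import all_boot all_order.
From mathcomp Require Import boolp classical_sets functions cardinality.
Set Implicit Arguments. Unset Strict Implicit. Unset Printing Implicit Defensive.
Import Order.TTheory.
Local Open Scope classical_set_scope.
Local Open Scope order_scope.

(* A Boolean algebra is a complemented distributive lattice with top and
   bottom (mathcomp's ctbDistrLatticeType). *)
Section BA.
Context {disp : Order.disp_t} {T : ctbDistrLatticeType disp}.

Definition complete_BA : Prop := forall X : set T, supremums X !=set0.

Definition bjoin (X : set T) : T := supremum \bot X.

Definition antichain (A : set T) : Prop :=
  (forall a, A a -> a != \bot) /\
  (forall a b, A a -> A b -> a <> b -> a `&` b = \bot).

Definition maximal_antichain (A : set T) : Prop :=
  antichain A /\ (forall B : set T, antichain B -> A `<=` B -> B = A).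

Definition refines (B A : set T) : Prop :=
  forall b, B b -> exists2 a, A a & b <= a.

Definition BA_filter (U : set T) : Prop :=
  U \top /\ ~ U \bot /\
  (forall a b, U a -> U b -> U (a `&` b)) /\
  (forall a b, U a -> a <= b -> U b).

Definition ultrafilter (U : set T) : Prop :=
  BA_filter U /\ (forall W : set T, BA_filter W -> U `<=` W -> W = U).

Definition Part := {A : set T | maximal_antichain A}.

Definition JPR_le (U V : set T) : Prop :=
  exists (g : Part -> Part)
         (f : forall A : Part, {x | proj1_sig (g A) x} -> {x | proj1_sig A x}),
    (forall (A : Part) (X : set T), X `<=` proj1_sig A ->
        (U (bjoin X) <->
         V (bjoin [set b | exists h : proj1_sig (g A) b,
                             X (proj1_sig (f A (exist _ b h)))]))) /\
    (forall A B : Part, refines (proj1_sig B) (proj1_sig A) ->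
        V (bjoin [set c | exists a b (ha : proj1_sig (g A) a)
                                     (hb : proj1_sig (g B) b),
                    proj1_sig (f B (exist _ b hb)) <=
                    proj1_sig (f A (exist _ a ha)) /\ c = a `&` b])).

(* Tukey reducibility of <U, >=> to <V, >=> *)
Definition tukey_le (U V : set T) : Prop :=
  exists (f : {u | U u} -> {v | V v}) (g : {v | V v} -> {u | U u}),
    forall u v, proj1_sig v <= proj1_sig (f u) -> proj1_sig (g v) <= proj1_sig u.

Definition tukey_maximal (V : set T) : Prop :=
  ultrafilter V /\ forall U, ultrafilter U -> tukey_le U V.

End BA.

(* Main.v *)
Require Import Defs.
From HB Require Import structures.
From mathcomp Require Import all_boot all_order.
From mathcomp Require Import boolp classical_sets functions cardinality wochoice.
Set Implicit Arguments. Unset Strict Implicit. Unset Printing Implicit Defensive.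
Import Order.TTheory Order.CTheory.
Local Open Scope classical_set_scope.

(** Hausdorff's theorem gives [2^|A|] independent subsets of the antichain [A];
their joins form an independent family in the algebra, indexed here by
[T * bool] since [|T| = 2^|A|].  The block of index [false] generates, together
with the complements of the meets of its infinite subfamilies, a filter all of
whose ultrafilter extensions are Tukey-maximal: sending [u] to the [u]-th
member maps every infinite set to an unbounded one.

The block of index [true] serves to build two such extensions [U true] and
[U false] as in Kunen's construction of incomparable ultrafilters.  Evaluated
at a fixed maximal antichain containing [A], a reduction of [U (~~ b)] to [U b]
yields [h : A -> T] such that, for all [Y] included in [A], the join of [Y] is
in [U (~~ b)] iff the join of [h @` Y] is in [U b].  There are only [2^|A|]
pairs [(b, h)]; they are defeated one at a time along a well-order of minimal
type.  At each stage only finitely many members of the block are spent: pick an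
unused member [Y], decide the join of [h @` Y] in [U b] so that independence of
the unused members is kept, and decide the join of [Y] the opposite way in
[U (~~ b)]. *)

(** * Comparison of cardinalities by injections *)

Definition emb (X Y : Type) : Prop := exists f : X -> Y, injective f.

Lemma emb_trans X Y Z : emb X Y -> emb Y Z -> emb X Z.
Proof. by move=> [f fi] [g gi]; exists (g \o f); exact: inj_comp. Qed.

Lemma emb_refl X : emb X X.
Proof. by exists id. Qed.

Lemma emb_prod X Y X' Y' : emb X X' -> emb Y Y' -> emb (X * Y) (X' * Y').
Proof.
move=> [f fi] [g gi]; exists (fun p => (f p.1, g p.2)).
by move=> [x y] [x' y'] [] /= /fi -> /gi ->.
Qed.

Lemma sval_inj X (S : set X) : injective (@sval X S).
Proof. by move=> [x Sx] [y Sy] /= xy; exact: eq_exist. Qed.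

Lemma emb_sig X (S : set X) : emb {x | S x} X.
Proof. by exists sval; exact: sval_inj. Qed.

Lemma emb_seq X Y : emb X Y -> emb (seq X) (seq Y).
Proof. by move=> [f fi]; exists (map f); exact: inj_map. Qed.

Lemma emb_of_rel X Y (r : X -> Y -> Prop) :
  (forall x, exists y, r x y) -> (forall x x' y, r x y -> r x' y -> x = x') ->
  emb X Y.
Proof.
move=> /choice[f fP] ri; exists f => x x' fxx'.
by apply: ri (fP x) _; rewrite fxx'.
Qed.

(** Zorn's lemma on graphs of partial bijections: a maximal one is total on one of the two sides,
    since otherwise a pair of missed points could be added. *)
Lemma emb_total X Y : emb X Y \/ emb Y X.
Proof.
pose P (M : set (X * Y)) := forall x y x' y', M (x, y) -> M (x', y') ->
  (x = x' <-> y = y').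
have [F FP tF|M [PM Mmax]] := @Zorn_bigcup _ P.
  move=> x y x' y' [M FM Mxy] [N FN Nxy].
  have [MN|NM] := tF _ _ FM FN.
    by apply: (FP _ FN) => //; exact: MN.
  by apply: (FP _ FM) => //; exact: NM.
have [dM|/existsNP[x0 nx0]] := pselect (forall x, exists y, M (x, y)).
  left; apply: (emb_of_rel dM) => x x' y Mx Mx'.
  by apply/(PM _ _ _ _ Mx Mx').
have [rM|/existsNP[y0 ny0]] := pselect (forall y, exists x, M (x, y)).
  right; apply: (emb_of_rel rM) => y y' x Mx Mx'.
  by apply/(PM _ _ _ _ Mx Mx').
have nM1 y : ~ M (x0, y) by move=> ?; apply: nx0; exists y.
have nM2 x : ~ M (x, y0) by move=> ?; apply: ny0; exists x.
exfalso; apply: (Mmax (M `|` [set (x0, y0)])).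
  split; first exact: subsetUl.
  by move=> /(_ (x0, y0)) H; apply: (nM1 y0); apply: H; right.
move=> x y x' y' [Mx|[-> ->]] [Mx'|[-> ->]] //; first exact: PM Mx Mx'.
  by split=> xx; [case: (nM1 y); rewrite -xx|case: (nM2 x); rewrite -xx].
by split=> xx; [case: (nM1 y'); rewrite xx|case: (nM2 x'); rewrite xx].
Qed.

(** * Squares and finite sequences of infinite types *)

Section Square.
Variable X : Type.

Let fld (D : set (X * X * X)) : set X := [set x | exists y z, D (x, y, z)].

(** The graph of an injection from the square of [fld D] into [fld D]. A set of triples carries its
    own domain, so that extension of partial pairings is plain inclusion. *)
Let pairing (D : set (X * X * X)) : Prop :=
  [/\ forall x y, fld D x -> fld D y -> exists z, D (x, y, z),
      forall x y z, D (x, y, z) -> fld D y /\ fld D z,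
      forall x y z z', D (x, y, z) -> D (x, y, z') -> z = z' &
      forall x y x' y' z, D (x, y, z) -> D (x', y', z) -> x = x' /\ y = y'].

Let maximal_pairing (D0 : set (X * X * X)) : pairing D0 ->
  exists D, [/\ D0 `<=` D, pairing D &
                forall D', D `<=` D' -> pairing D' -> D' `<=` D].
Proof.
(* Joining [D0] to [G] inside the predicate makes it hold for the union of the empty chain as
   well. *)
move=> pD0; have [F FP tF|G [PG Gmax]] :=
  @Zorn_bigcup _ (fun G => pairing (G `|` D0)).
  have [[G0 FG0]|nF] := pselect (exists G, F G); last first.
    suff -> : \bigcup_(G in F) G `|` D0 = D0 by [].
    by rewrite bigcup0 ?set0U // => G FG; case: nF; exists G.
  set W := _ `|` D0.
  have WP1 p : W p -> exists2 G, F G & (G `|` D0) p.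
    case=> [[G FG Gp]|D0p]; first by exists G => //; left.
    by exists G0 => //; right.
  have WP G : F G -> G `|` D0 `<=` W.
    by move=> FG p [Gp|Dp]; [left; exists G|right].
  have fW G x : F G -> fld (G `|` D0) x -> fld W x.
    by move=> FG [y [z h]]; exists y, z; exact: WP FG _ h.
  have WP2 p q : W p -> W q -> exists2 G, F G & (G `|` D0) p /\ (G `|` D0) q.
    move=> /WP1[G FG Gp] /WP1[H FH Hq].
    have [GH|HG] := tF _ _ FG FH; [exists H|exists G] => //; split=> //.
      by case: Gp => [/GH|]; [left|right].
    by case: Hq => [/HG|]; [left|right].
  split.
  - move=> x y [a [b xW]] [c [d yW]]; have [G FG [Gx Gy]] := WP2 _ _ xW yW.
    have [h _ _ _] := FP _ FG.
    have [|| z Gz] := h x y; [by exists a, b|by exists c, d|].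
    by exists z; exact: WP Gz.
  - move=> x y z /WP1[G FG Gp]; have [_ h _ _] := FP _ FG.
    by have [/(fW _ _ FG) ? /(fW _ _ FG)] := h _ _ _ Gp.
  - move=> x y z z' p q; have [G FG [Gp Gq]] := WP2 _ _ p q.
    by have [_ _ h _] := FP _ FG; exact: h Gp Gq.
  - move=> x y x' y' z p q; have [G FG [Gp Gq]] := WP2 _ _ p q.
    by have [_ _ _ h] := FP _ FG; exact: h Gp Gq.
exists (G `|` D0); split=> [||D' GD' pD'];
  [exact: subsetUr|by []|].
have [D'G|nD'G] := pselect (D' `<=` G); first by move=> p /D'G; left.
case: (Gmax D'); first by split=> // p Gp; apply: GD'; left.
by rewrite (_ : D' `|` D0 = D')// setUidl// => p D0p; apply: GD'; right.
Qed.

(** Transport along [u]; it yields both the countable pairing to start from and the extension that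
    contradicts maximality. *)
Let pairing_of_inj Y (u : Y -> X) (f : Y * Y -> Y) : injective u ->
  injective f -> pairing [set p | exists y y',
    p = (u y, u y', u (f (y, y')))].
Proof.
move=> ui fi; set D := [set p | _].
have fldu y : fld D (u y) by exists (u y), (u (f (y, y))), y, y.
split.
- move=> x x' [_ [_ [y [_ [-> _ _]]]]] [_ [_ [y' [_ [-> _ _]]]]].
  by exists (u (f (y, y'))), y, y'.
- by move=> x x' z [y [y' [_ -> ->]]].
- by move=> x x' z z' [y [y' [-> -> ->]]] [a [b [/ui <- /ui <- ->]]].
- move=> x x' a a' z [y [y' [-> -> ->]]] [b [b' [-> -> /ui/fi]]].
  by move=> [-> ->].
Qed.

(** Let [S] be the field of a maximal pairing that extends a countable one. If the complement [E] of
    [S] embeds in [S], then [X] embeds in two tagged copies of [S], hence in [S], and the pairing on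
    [S] suffices. Otherwise [S] embeds in [E], which leaves room to extend the pairing. *)
Lemma emb_square : emb nat X -> emb (X * X) X.
Proof.
move=> [n0 n0i]; pose f0 (p : nat * nat) : nat := choice.pickle p.
have f0i : injective f0 by exact: pcan_inj choice.pickleK.
have [D [D0D [Dt Dc Df Di] Dmax]] :=
  maximal_pairing (pairing_of_inj n0i f0i).
pose S := {x | fld D x}.
have Sinj (a b : S) : sval a = sval b -> a = b by exact: sval_inj.
have nS : exists c : nat -> S, injective c.
  have h n : fld D (n0 n).
    by exists (n0 n), (n0 (f0 (n, n))); apply: D0D; exists n, n.
  by exists (fun n => exist _ (n0 n) (h n)) => m n [] /n0i.
have [f fi fD] : exists2 f : S * S -> S, injective f &
    forall a b, D (sval a, sval b, sval (f (a, b))).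
  have /choice[f fP] : forall p : S * S, exists z, D (sval p.1, sval p.2, z).
    by move=> [[x Dx] [y Dy]]; exact: Dt.
  have h p : fld D (f p) by have [] := Dc _ _ _ (fP p).
  exists (fun p => exist _ (f p) (h p)); last by move=> a b; exact: fP (a, b).
  move=> [a b] [a' b'] [] fpq; have := fP (a', b'); rewrite -fpq.
  by move=> /(Di _ _ _ _ _ (fP (a, b)))[/= /Sinj -> /Sinj ->].
case: nS => c ci.
pose E := {x | ~ fld D x}.
have [[j ji]|[j ji]] := emb_total E S.
  suff XS : emb X S.
    apply: emb_trans (emb_prod XS XS) _.
    by apply: emb_trans (emb_sig _); exists f.
  pose r x (y : S) := (exists a, sval a = x /\ y = f (a, c 0%N)) \/
    (exists b : E, sval b = x /\ y = f (j b, c 1%N)).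
  apply: (@emb_of_rel _ _ r) => [x|x x' y].
    have [Dx|Dx] := pselect (fld D x).
      by exists (f (exist _ x Dx, c 0%N)); left; exists (exist _ x Dx).
    by exists (f (j (exist _ x Dx), c 1%N)); right; exists (exist _ x Dx).
  move=> [[a [<- ->]]|[a [<- ->]]] [[b [<- /fi]]|[b [<- /fi]]].
  - by move=> [->].
  - by move=> [_ /ci].
  - by move=> [_ /ci].
  - by move=> [/ji ->].
exfalso.
(* Any embedding of S into the complement of the field of D would let us
   extend the pairing D to the union of the two copies of S. *)
pose u (p : bool * S) : X := if p.1 then sval (j p.2) else sval p.2.
(* Two elements of the old copy keep their value under [f], so that [D] is extended. Every other
   pair goes to the new copy, with a tag recording the copies of its entries to keep [v]
   injective. *)
pose tag (b b' : bool) : nat := choice.pickle (b, b').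
pose k (p q : bool * S) : S := f (f (p.2, q.2), c (tag p.1 q.1)).
pose v p q : bool * S :=
  if p.1 || q.1 then (true, k p q) else (false, f (p.2, q.2)).
have ui : injective u.
  move=> [[] a] [[] b]; rewrite /u /=.
  - by move=> /sval_inj/ji ->.
  - by case: (j a) (svalP b) => x /= nx + xb; rewrite -xb.
  - by case: (j b) (svalP a) => x /= nx + xb; rewrite xb.
  - by move=> /Sinj ->.
have vi : injective (fun pq => v pq.1 pq.2).
  move=> [[b a] [b' a']] [[d e] [d' e']]; rewrite /v /=.
  case: ifP => bb; case: ifP => dd //; last first.
    by case: b b' d d' bb dd => [] [] [] [] //= _ _ [] /fi[-> ->].
  move=> [] /fi[] /fi[-> ->] /ci /(pcan_inj choice.pickleK)[-> ->] //.
have Dsub : D `<=` [set p | exists y y', p = (u y, u y', u (v y y'))].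
  move=> [[x y] z] Dp; have [Dy Dz] := Dc _ _ _ Dp.
  have Dx : fld D x by exists y, z.
  exists (false, exist _ x Dx), (false, exist _ y Dy); rewrite /u /v /=.
  by congr (_, _); apply: Df Dp _; exact: (fD (exist _ x Dx) (exist _ y Dy)).
have := Dmax _ Dsub (pairing_of_inj ui vi).
have t : S := c 0%N.
move=> /(_ (u (true, t), u (true, t), u (v (true, t) (true, t)))) h.
case: (svalP (j t)); exists (u (true, t)), (u (v (true, t) (true, t))).
by apply: h; exists (true, t), (true, t).
Qed.
End Square.

Lemma emb_natr X : emb nat X -> emb (X * nat) X.
Proof.
move=> nX; apply: emb_trans (emb_square nX).
exact: emb_prod (emb_refl X) nX.
Qed.

Lemma emb_seq_self X : emb nat X -> emb (seq X) X.
Proof.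
move=> nX; apply: emb_trans (emb_natr nX).
have [x0 _] := nX; have [p pi] := emb_square nX.
(* The length is kept beside the code because the code of the empty list may also be a value of
   [p]. *)
pose enc s := foldr (fun x y => p (x, y)) (x0 0%N) s.
exists (fun s => (enc s, size s)).
elim=> [|x s ih] [|y t] // [] /pi[-> e] sz.
by rewrite (ih t) // e sz.
Qed.

Lemma emb_nat_infinite X : emb nat X <-> infinite_set [set: X].
Proof.
rewrite infiniteP; split=> [[f fi]|/card_leP[f]].
  apply/card_leP; apply/injfunPex.
  exists (fun n => to_setT (f (\val n))) => // m n _ _.
  by move=> /(congr1 set_val) /= /fi /val_inj.
exists (fun n => \val (f (to_setT n))) => m n /val_inj.
by move=> /(inj (in_setT _) (in_setT _)) /(congr1 set_val).
Qed.

(** * Well-orders whose type is a cardinal *)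

Record initial_well_order (Q : Type) (lt : Q -> Q -> Prop) : Prop := {
  iwo_wf : well_founded lt;
  iwo_trans : forall x y z, lt x y -> lt y z -> lt x z;
  iwo_total : forall x y, [\/ lt x y, x = y | lt y x];
  iwo_init : forall q, ~ emb Q {x | lt x q} }.

Lemma well_orderable (Q : Type) : exists lt : Q -> Q -> Prop,
  [/\ well_founded lt, forall x y z, lt x y -> lt y z -> lt x z &
      forall x y, [\/ lt x y, x = y | lt y x]].
Proof.
have [R Rwo] := well_ordering_principle {classic Q}.
have wm (A : set Q) : A !=set0 -> exists2 z, A z & forall x, A x -> R z x.
  move=> [a Aa]; have [|z [[zA zm] _]] := Rwo [pred x | `[< A x >]].
    by exists a; apply/asboolP.
  exists z; first exact/asboolP.
  by move=> x Ax; apply: zm; apply/asboolP.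
have Rtot x y : R x y \/ R y x.
  have [|z [->|->] h] := wm [set x; y]; first by exists x; left.
    by left; apply: h; right.
  by right; apply: h; left.
have Ranti x y : R x y -> R y x -> x = y.
  move=> xy yx; have [|z [_ zu]] := Rwo (pred2 (x : {classic Q}) y).
    by exists x; rewrite inE eqxx.
  have Rxx a : R a a by have [] := Rtot a a.
  transitivity z; [apply/esym|]; apply: zu; split; rewrite ?inE ?eqxx ?orbT //;
    by move=> a; rewrite inE => /orP[/eqP->|/eqP->].
have nR x y : ~ R y x -> R x y by case: (Rtot x y).
(* As [R] is total and antisymmetric, this is its strict part. *)
exists (fun x y => ~ R y x); split.
- move=> q; apply: contrapT => nq.
  have [|z zA zm] := wm [set x | ~ Acc (fun x y => ~ R y x) x]; first by exists q.
  apply: zA; split=> y zy; apply: contrapT => ny; exact/zy/zm.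
- move=> x y z yx zy zx.
  have [|a Aa am] := wm [set x; y; z]; first by exists x; left; left.
  have ax : R a x by apply: am; left; left.
  have ay : R a y by apply: am; left; right.
  have az : R a z by apply: am; right.
  case: Aa => [[e|e]|e]; rewrite e in ax ay az => //.
  by apply: zy; rewrite (Ranti _ _ zx az).
- move=> x y; have [yx|] := pselect (R y x); last by constructor 1.
  have [xy|] := pselect (R x y); last by constructor 3.
  by constructor 2; exact: Ranti.
Qed.

(** If some proper segment of a well-order receives an injection from [Q], take the least such
    segment and pull its order back along the injection. *)
Lemma ex_initial_well_order (Q : Type) :
  exists lt : Q -> Q -> Prop, initial_well_order lt.
Proof.
have [lt [wf tr tt]] := well_orderable Q.
have [h|/existsNP[q0 /contrapT q0P]] := pselect (forall q, ~ emb Q {x | lt x q}).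
  by exists lt.
have [q [[f fi] qm]] : exists q, emb Q {x | lt x q} /\
    forall y, lt y q -> ~ emb Q {x | lt x y}.
  elim/(well_founded_ind wf): q0 q0P => q ih qP.
  have [h|/existsNP[y /not_implyP[yq /contrapT yP]]] :=
    pselect (forall y, lt y q -> ~ emb Q {x | lt x y}); first by exists q.
  exact: ih y yq yP.
exists (fun x y => lt (sval (f x)) (sval (f y))); split.
- move=> x; have [a] : exists a, sval (f x) = a by exists (sval (f x)).
  elim/(well_founded_ind wf): a x => a ih x e; split=> y yx.
  by apply: (ih (sval (f y))); rewrite // -e.
- by move=> x y z; exact: tr.
- move=> x y; have [] := tt (sval (f x)) (sval (f y)).
  + by constructor 1.
  + by move=> /sval_inj/fi ->; constructor 2.
  + by constructor 3.
- move=> y h; apply: (qm (sval (f y)) (svalP (f y))).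
  apply: emb_trans h _.
  exists (fun a : {x | lt (sval (f x)) (sval (f y))} =>
    exist (fun x => lt x (sval (f y))) (sval (f (sval a))) (svalP a)).
  by move=> a b [] /sval_inj/fi/sval_inj.
Qed.

Lemma initial_seq_not_cover (Q : Type) (lt : Q -> Q -> Prop) (I : eqType)
    (r : Q -> seq I) (q : Q) :
  initial_well_order lt -> emb nat I -> emb Q I ->
  exists i, forall y, lt y q -> i \notin r y.
Proof.
move=> iwo nI QI; apply: contrapT => /forallNP h.
have {}h i : exists p : {y | lt y q} * nat, onth (r (sval p.1)) p.2 = Some i.
  have /existsNP[y /not_implyP[yq /negP/negPn iy]] := h i.
  by have /onthP[n hn] := iy; exists (exist _ y yq, n).
have IS : emb I ({y | lt y q} * nat).
  by apply: (emb_of_rel h) => x x' p -> [].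
have [/(emb_natr)|fS] := pselect (emb nat {y | lt y q}).
  by move=> /(emb_trans IS)/(emb_trans QI); exact: iwo_init.
have /emb_nat_infinite := nI; apply.
have {}fS : finite_set [set: {y | lt y q}].
  by apply: contrapT => /emb_nat_infinite.
apply: (@sub_finite_set _ _ (\bigcup_(y in [set: {y | lt y q}]) [set` r (sval y)])).
  move=> i _; have [p hp] := h i; exists p.1 => //=.
  by apply/onthP; exists p.2.
by apply: bigcup_finite => // y _; exact: finite_seq.
Qed.

(** * Powersets and independent families of sets *)

Lemma emb_powerset X Y : emb X Y -> emb (set X) (set Y).
Proof.
move=> [f fi]; exists (fun S => f @` S) => S S' e; apply/seteqP; split=> x Sx.
  have : (f @` S) (f x) by exists x.
  by rewrite e => -[y S'y /fi <-].
have : (f @` S') (f x) by exists x.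
by rewrite -e => -[y S'y /fi <-].
Qed.

Lemma emb_nat_of_powerset X Y : emb nat X -> emb X (set Y) -> emb nat Y.
Proof.
move=> nX XY; apply/emb_nat_infinite => fY.
have /emb_nat_infinite := nX; apply.
have [n Yn] : exists n, emb Y 'I_n.
  have [n /card_bijP[f [g fK gK]]] := fY; exists n.
  exists (fun y => Ordinal (set_mem (valP (f (to_setT y))))).
  by move=> y y' [] /val_inj /(can_inj fK) /(congr1 set_val).
have [h hi] := emb_trans XY (emb_powerset Yn).
pose k x : {set 'I_n} := [set i | `[< h x i >]]%SET.
apply: (@card_le_finite _ _ _ [set: {set 'I_n}]); last exact: finite_finset.
apply/card_leP; apply/injfunPex.
exists (fun x => to_setT (k (\val x))) => // x y _ _ /(congr1 set_val) /= kxy.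
apply/val_inj/hi/seteqP; split=> i hi';
  have := congr1 (fun A : {set 'I_n} => i \in A) kxy; rewrite !inE /=.
  by rewrite (asboolT hi') => /esym/asboolP.
by rewrite (asboolT hi') => /asboolP.
Qed.

(** $(2^\kappa)^\kappa=2^{\kappa\cdot\kappa}=2^\kappa$, by uncurrying. *)
Lemma emb_fun_powerset X Y : emb nat X -> emb Y (set X) -> emb (X -> Y) (set X).
Proof.
move=> nX [c ci]; apply: emb_trans (emb_powerset (emb_square nX)).
exists (fun h => [set p | c (h p.1) p.2]) => h h' e.
apply/funext => x; apply/ci/funext => y.
exact: (congr1 (fun S : set (X * X) => S (x, y)) e).
Qed.

(* Hausdorff's family: a point of [K] codes a finite [F] together with a
   finite list of tagged traces on [F]. *)
Lemma independent_family (K T : eqType) (b : T -> set K) :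
  emb nat K -> injective b ->
  exists Z : T * bool -> set K, forall (e : T * bool -> bool)
    (s : seq (T * bool)), exists k, forall i, i \in s -> (Z i k <-> e i).
Proof.
move=> nK bi.
have sK := emb_seq_self nK.
have bK : emb bool K.
  by apply: emb_trans nK; exists nat_of_bool; case=> [] [].
have [psi psii] : emb (seq K * seq (seq K * bool)) K.
  apply: emb_trans (emb_square nK); apply: (emb_prod sK).
  apply: (emb_trans _ sK); apply: emb_seq.
  exact: (emb_trans (emb_prod sK bK) (emb_square nK)).
pose tr (F : seq K) t := [seq x <- F | `[< b t x >]].
exists (fun i => [set k | exists F L, k = psi (F, L) /\ (tr F i.1, i.2) \in L]).
move=> e s.
have /choice[w wP] : forall p : T * T, exists x, p.1 <> p.2 ->
    ~ (b p.1 x <-> b p.2 x).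
  move=> [t t']; have [->|tt'] := pselect (t = t').
    by have [f _] := nK; exists (f 0%N).
  apply: contrapT => /forallNP h; apply: tt'; apply: bi.
  apply/funext => x; apply/propext; apply: contrapT => n.
  by apply: (h x).
(* [F] contains a point separating any two distinct sets named in [s], so these have distinct traces
   on [F]. *)
pose F := [seq w (i.1, j.1) | i <- s, j <- s].
have trF i j : i \in s -> j \in s -> tr F i.1 = tr F j.1 -> i.1 = j.1.
  move=> si sj e1; apply: contrapT => /(wP (i.1, j.1)); apply => /=.
  have wF : w (i.1, j.1) \in F by apply/allpairsP; exists (i, j).
  have := congr1 (fun l : seq K => w (i.1, j.1) \in l) e1.
  by rewrite /= !mem_filter wF !andbT; exact: asbool_eq_equiv.
(* The code lists the traces of exactly those [i] in [s] that must contain the point. *)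
exists (psi (F, [seq (tr F i.1, i.2) | i <- s & e i])) => i si; split=> /=.
  move=> [F' [L [/psii[<- <-]]]] /mapP[j]; rewrite mem_filter => /andP[ej sj].
  move=> [/trF e1 e2]; rewrite (_ : i = j)//.
  by rewrite [LHS]surjective_pairing e2 (e1 si sj) -surjective_pairing.
move=> ei; do 2 eexists; split; first by [].
by apply: map_f; rewrite mem_filter ei.
Qed.

Local Open Scope order_scope.

(** * Joins, meets and ultrafilters in a Boolean algebra *)

Section BooleanAlgebra.
Context {disp : Order.disp_t} {T : ctbDistrLatticeType disp}.
Implicit Types (x y : T) (X G : set T) (l : seq T).

Lemma bjoinP X : @complete_BA _ T -> supremums X (bjoin X).
Proof.
(* On the empty set [supremum] returns its default value, here [\bot], which is the correct join. *)
move=> cT; rewrite /bjoin /supremum; case: ifPn => [/eqP ->|_].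
  by split=> [x //|x _]; exact: le0x.
by case: xgetP => [x _ //|h]; have [x /h] := cT X.
Qed.

Lemma bjoin_ub X x : @complete_BA _ T -> X x -> x <= bjoin X.
Proof. by move=> cT; have [h _] := bjoinP X cT; exact: h. Qed.

Lemma bjoin_le X y : @complete_BA _ T -> (forall x, X x -> x <= y) -> bjoin X <= y.
Proof. by move=> cT h; have [_] := bjoinP X cT; apply. Qed.

Lemma bjoin_disjoint X y : @complete_BA _ T ->
  (forall x, X x -> x `&` y = \bot) -> bjoin X `&` y = \bot.
Proof.
move=> cT h; apply/eqP; rewrite disj_leC; apply: bjoin_le => // x Xx.
by rewrite -disj_leC h.
Qed.

Definition bmeet X : T := ~` bjoin [set ~` x | x in X].

Lemma bmeet_lb X x : @complete_BA _ T -> X x -> bmeet X <= x.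
Proof.
move=> cT Xx; rewrite -[leRHS]complK leC; apply: bjoin_ub => //.
by exists x.
Qed.

Lemma bmeet_ge X y : @complete_BA _ T -> (forall x, X x -> y <= x) -> y <= bmeet X.
Proof.
move=> cT h; rewrite -[leLHS]complK leC; apply: bjoin_le => // _ [x Xx <-].
by rewrite leC h.
Qed.

Definition centered G : Prop :=
  forall l, (forall x, x \in l -> G x) -> \meet_(x <- l) x != \bot.

Lemma filter_meet (U : set T) l : BA_filter U -> (forall x, x \in l -> U x) ->
  U (\meet_(x <- l) x).
Proof.
move=> [U1 [_ [UI _]]]; elim: l => [|x l ih] h; first by rewrite big_nil.
rewrite big_cons; apply: UI; first by apply: h; rewrite mem_head.
by apply: ih => y yl; apply: h; rewrite inE yl orbT.
Qed.

Lemma filter_centered (U : set T) : BA_filter U -> centered U.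
Proof.
move=> fU l /(filter_meet fU); apply: contraPneq => ->.
by case: fU => _ [].
Qed.

Lemma filter_proper (U : set T) x : BA_filter U -> U x -> ~ U (~` x).
Proof.
by move=> [_ [U0 [UI _]]] Ux /(UI _ _ Ux); rewrite meetxC.
Qed.

Lemma meet_seq_le (l : seq T) x : x \in l -> \meet_(y <- l) y <= x.
Proof. by move=> xl; exact: meets_inf_seq. Qed.

(** Reduces lists from a set enlarged by [x] to lists from the set itself. *)
Lemma meet_seq_rem l x :
  x `&` \meet_(y <- [seq y <- l | y != x]) y <= \meet_(y <- l) y.
Proof.
apply/meetsP_seq => y yl _; have [->|yx] := eqVneq y x; first exact: leIl.
by apply: le_trans (leIr _ _) (meet_seq_le _); rewrite mem_filter yx.
Qed.

(** A maximal centered set above [G] contains every element compatible with its finite meets, hence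
    is a filter; it is a maximal one because filters are centered. *)
Lemma ultrafilter_of_centered G : centered G ->
  exists U, ultrafilter U /\ G `<=` U.
Proof.
move=> cG; have [F FP tF|M [PM Mmax]] :=
  @Zorn_bigcup _ (fun M => centered (M `|` G)%classic).
  have [[M0 FM0]|nF] := pselect (exists M, F M); last first.
    suff -> : (\bigcup_(M in F) M `|` G)%classic = G by [].
    by rewrite bigcup0 ?set0U // => M FM; case: nF; exists M.
  move=> l hl.
  have [M FM hM] : exists2 M, F M & forall x, x \in l -> (M `|` G)%classic x.
    elim: l hl => [|x l ih] h; first by exists M0.
    have [|M FM hM] := ih; first by move=> y yl; apply: h; rewrite inE yl orbT.
    have [[N FN Nx]|Gx] := h x (mem_head _ _); last first.
      by exists M => // y; rewrite inE => /orP[/eqP->|/hM//]; right.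
    have [MN|NM] := tF _ _ FM FN.
      exists N => // y; rewrite inE => /orP[/eqP->|/hM[/MN|]]; by [left|right].
    exists M => // y; rewrite inE => /orP[/eqP->|/hM//].
    by left; exact: NM.
  exact: FP hM.
have GM : G `<=` M.
  apply: contrapT => nGM; apply: (Mmax (M `|` G)%classic).
    by split=> [|MGM]; [exact: subsetUl|apply: nGM => x Gx; apply: MGM; right].
  by rewrite -setUA setUid.
rewrite (setUidl GM) in PM.
have Min x : (forall l, (forall y, y \in l -> M y) ->
    x `&` \meet_(y <- l) y != \bot) -> M x.
  move=> h; apply: contrapT => nMx; apply: (Mmax (M `|` [set x])%classic).
    by split=> [|Mx]; [exact: subsetUl|apply: nMx; apply: Mx; right].
  rewrite setUAC (setUidl GM) => l hl.
  apply: contraNneq (h [seq y <- l | y != x] _) => [e|].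
    by rewrite -lex0 -e meet_seq_rem.
  by move=> y; rewrite mem_filter => /andP[yx /hl[//|/eqP]]; rewrite (negbTE yx).
have fM : BA_filter M.
  split; first by apply: Min => l /PM; rewrite meet1x.
  split.
    move=> M0; have := PM [:: \bot]; rewrite big_seq1 eqxx => /(_ _)/negP; apply=> //.
    by move=> x; rewrite inE => /eqP ->.
  split.
    move=> a b Ma Mb; apply: Min => l hl; have := PM [:: a, b & l].
    rewrite !big_cons meetA; apply => x; rewrite !inE.
    by case/or3P => [/eqP->|/eqP->|/hl].
  move=> a b Ma ab; apply: Min => l hl; have : a `&` \meet_(y <- l) y != \bot.
    have := PM (a :: l); rewrite big_cons; apply => x; rewrite inE.
    by case/orP => [/eqP->|/hl].
  apply: contra_neq => e; apply/eqP; rewrite -lex0 -e; exact: leI2.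
exists M; split=> //; split=> // W fW MW.
apply: contrapT => nWM; apply: (Mmax W).
  by split=> // WM; apply: nWM; apply/seteqP.
by rewrite (setUidl (subset_trans GM MW)); exact: filter_centered.
Qed.

End BooleanAlgebra.

(** Existence of a next value is asked only stage by stage in the conclusion, so that it can be
    proved afterwards by induction from the properties of the earlier values. *)
Lemma wf_choice (Q D : Type) (lt : Q -> Q -> Prop) (P : Q -> (Q -> D) -> D -> Prop) :
  well_founded lt -> inhabited D ->
  (forall q d d' x, (forall y, lt y q -> d y = d' y) -> P q d x -> P q d' x) ->
  exists d : Q -> D, forall q, (exists x, P q d x) -> P q d (d q).
Proof.
move=> wf [d0] Ploc.
pose ext q (rec : forall y, lt y q -> D) y :=
  if pselect (lt y q) is left h then rec y h else d0.
pose step q rec : D :=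
  if pselect (exists x, P q (ext q rec) x) is left h then sval (cid h) else d0.
pose d := Fix wf (fun _ => D) step.
have dE q : d q = step q (fun y _ => d y).
  apply: (Fix_eq wf (fun _ => D)) => {}q f g fg; congr step.
  by apply: functional_extensionality_dep => y; apply/funext => h.
have ed q y : lt y q -> ext q (fun y _ => d y) y = d y.
  by rewrite /ext; case: pselect.
exists d => q [x Px]; rewrite [in P _ _ (d q)]dE.
apply: (Ploc q (ext q (fun y _ => d y))) => [y|]; first exact: ed.
rewrite /step; case: pselect => [h|[]]; first by case: cid.
by exists x; apply: Ploc Px => y yq; rewrite ed.
Qed.

(** * Independence modulo a set of generators, and the transfinite construction *)

Section Independence.
Context {disp : Order.disp_t} {T : ctbDistrLatticeType disp} {I : eqType}.
Variable X : I -> T.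
Implicit Types (G : set T) (R : set I) (e : I -> bool) (l : seq T) (s : seq I).

Definition literal e i : T := if e i then X i else ~` X i.

(* The signs [e] are total, so that no consistency condition on [s] is needed. *)
Definition indep_mod G R : Prop := forall l e s,
  (forall x, x \in l -> G x) -> (forall i, i \in s -> ~ R i) ->
  \meet_(x <- l) x `&` \meet_(i <- s) literal e i != \bot.

Lemma sub_indep_mod G G' R R' : G' `<=` G -> R `<=` R' ->
  indep_mod G R -> indep_mod G' R'.
Proof.
move=> GG RR h l e s lG sR; apply: h => [x /lG /GG //|i /sR + Ri].
by apply; exact: RR.
Qed.

Lemma indep_mod_centered G R : indep_mod G R -> centered G.
Proof.
by move=> h l lG; have := h l xpredT [::] lG; rewrite big_nil meetx1; apply.
Qed.

Lemma indep_mod_add G R w :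
  (forall l e s, (forall x, x \in l -> G x) -> (forall i, i \in s -> ~ R i) ->
    w `&` (\meet_(x <- l) x `&` \meet_(i <- s) literal e i) != \bot) ->
  indep_mod (G `|` [set w])%classic R.
Proof.
move=> h l e s lG sR; have := h [seq y <- l | y != w] e s.
move=> /(_ _ sR) h'; apply: contraNneq (h' _) => [e0|]; last first.
  by move=> y; rewrite mem_filter => /andP[yw /lG[//|/eqP]]; rewrite (negbTE yw).
rewrite -lex0 -e0 meetA; apply: leI2 => //; exact: meet_seq_rem.
Qed.

(** Any finite combination may be adjoined once its indices count as spent: later literals avoid
    [s], so both sign functions merge into one. *)
Lemma indep_mod_combine G R l e s : indep_mod G R ->
  (forall x, x \in l -> G x) -> (forall i, i \in s -> ~ R i) ->
  indep_mod (G `|` [set (\meet_(x <- l) x `&` \meet_(i <- s) literal e i)%O])%classic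
            (R `|` [set` s])%classic.
Proof.
move=> h lG sR; apply: indep_mod_add => l' e' s' l'G s'R.
pose e2 i := if i \in s then e i else e' i.
have -> : \meet_(i <- s) literal e i = \meet_(i <- s) literal e2 i.
  by apply: eq_big_seq => i si; rewrite /literal /e2 si.
have -> : \meet_(i <- s') literal e' i = \meet_(i <- s') literal e2 i.
  apply: eq_big_seq => i si; rewrite /literal /e2; case: (boolP (i \in s)) => // si'.
  by exfalso; apply: (s'R i si); right.
rewrite meetACA -!big_cat; apply: h => x; rewrite mem_cat => /orP[].
- exact: lG.
- exact: l'G.
- exact: sR.
- by move=> /s'R h Rx; apply: h; left.
Qed.

(** With [i] set aside, either [w] can be adjoined on side [c], or some finite combination is
    disjoint from [w] and is adjoined instead, which forces the complement of [w]. In both cases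
    side [~~ c] receives the literal of [i] that contradicts the decision. *)
Lemma indep_step (G : bool -> set T) R i w c :
  (forall b, indep_mod (G b) R) -> ~ R i ->
  exists (x : bool -> T) (r : seq I),
    (forall b, indep_mod (G b `|` [set x b])%classic (R `|` [set` r])%classic) /\
    ((x c <= w /\ x (~~ c) <= ~` X i) \/ (x c <= ~` w /\ x (~~ c) <= X i)).
Proof.
move=> h nRi.
have hlit b e (r : seq I) : i \in r ->
    indep_mod (G b `|` [set literal e i])%classic (R `|` [set` r])%classic.
  move=> ir; have := @indep_mod_combine (G b) R [::] e [:: i] (h b).
  rewrite big_nil big_seq1 meet1x => h'; apply: sub_indep_mod (h' _ _) => //.
    by move=> j [|]; [left|rewrite /= inE => /eqP ->; right].
  by move=> j; rewrite inE => /eqP ->.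
have [/indep_mod_add hw|] := pselect (forall l e s, (forall x, x \in l -> G c x) ->
    (forall j, j \in s -> ~ (R `|` [set i])%classic j) ->
    w `&` (\meet_(x <- l) x `&` \meet_(j <- s) literal e j) != \bot).
  exists (fun b => if b == c then w else ~` X i), [:: i]; split; last first.
    by left; rewrite eqxx; case: c {hw}.
  move=> b /=; case: (b =P c) => [->|_].
    apply: sub_indep_mod hw => // j [|->]; first by left.
    by right; rewrite /= mem_head.
  exact: (hlit b xpred0 _ (mem_head i [::])).
move=> /existsNP[l /existsNP[e /existsNP[s /not_implyP[lG /not_implyP[sR /negP]]]]].
rewrite negbK => w0.
pose y := \meet_(x <- l) x `&` \meet_(j <- s) literal e j.
exists (fun b => if b == c then y else X i), (i :: s); split; last first.
  right; rewrite eqxx -disj_leC meetC w0; split=> //.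
  by case: c {lG}.
move=> b /=; case: (b =P c) => [->|_]; last exact: (hlit b xpredT _ (mem_head i s)).
have sR' j : j \in s -> ~ R j by move=> /sR + Rj; apply; left.
have := @indep_mod_combine _ _ l e s (h c) lG sR'.
apply: sub_indep_mod => // j [|sj].
  by left.
by right; exact: (@mem_behead _ (i :: s)).
Qed.

Context {Q : Type}.
Variables (lt : Q -> Q -> Prop) (G0 : set T) (R0 : set I).
Variables (w : Q -> I -> T) (side : Q -> bool).
Hypothesis lt_wf : well_founded lt.
Hypothesis lt_trans : forall x y z, lt x y -> lt y z -> lt x z.
Hypothesis lt_total : forall x y, [\/ lt x y, x = y | lt y x].
Hypothesis fresh : forall (r : Q -> seq I) q,
  exists i, ~ R0 i /\ forall y, lt y q -> i \notin r y.
Hypothesis indep0 : indep_mod G0 R0.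

(** The elements adjoined on the two sides, and the indices spent on them. *)
Let stage : Type := (bool -> T) * seq I.
Let gens (d : Q -> stage) (S : set Q) b : set T :=
  (G0 `|` [set (d q).1 b | q in S])%classic.
Let used (d : Q -> stage) (S : set Q) : set I :=
  (R0 `|` [set i | exists2 q, S q & i \in (d q).2])%classic.
Let spec q (d : Q -> stage) (x : stage) : Prop :=
  (forall b, indep_mod (gens d (lt^~ q) b `|` [set x.1 b])%classic
                       (used d (lt^~ q) `|` [set` x.2])%classic) /\
  exists i, (x.1 (side q) <= w q i /\ x.1 (~~ side q) <= ~` X i) \/
            (x.1 (side q) <= ~` w q i /\ x.1 (~~ side q) <= X i).

(** A finite list of generators involves finitely many stages; the specification of the last of them
    covers the whole list. *)
Let indep_gens d (S : set Q) : (forall q y, S q -> lt y q -> S y) ->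
  (forall q, S q -> spec q d (d q)) ->
  forall b, indep_mod (gens d S b) (used d S).
Proof.
move=> Sdown Sspec b l e s lG sR.
have [l0|[q [Sq lq]]] : (forall x, x \in l -> G0 x) \/ exists q, S q /\
    forall x, x \in l -> (gens d (lt^~ q) b `|` [set (d q).1 b])%classic x.
  elim: l lG => [|x l ih] lG; first by left.
  have {}ih := ih (fun y yl => lG y (@mem_behead _ (x :: l) y yl)).
  have [G0x|[q Sq xq]] := lG x (mem_head _ _).
    case: ih => [l0|[q [Sq lq]]]; [left|right; exists q; split=> //].
      by move=> y; rewrite inE => /orP[/eqP->|/l0].
    by move=> y; rewrite inE => /orP[/eqP->|/lq//]; left; left.
  right; case: ih => [l0|[q' [Sq' lq]]].
    exists q; split=> // y; rewrite inE => /orP[/eqP->|/l0 ?].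
      by right; rewrite /= xq.
    by left; left.
  have [qq'|?|q'q] := lt_total q q'.
  - exists q'; split=> // y; rewrite inE => /orP[/eqP->|/lq //].
    by left; right; exists q.
  - subst q'; exists q; split=> // y; rewrite inE => /orP[/eqP->|/lq //].
    by right; rewrite /= xq.
  - exists q; split=> // y; rewrite inE => /orP[/eqP->|/lq].
      by right; rewrite /= xq.
    move=> [[?|[q2 ? <-]]|->]; left; [by left|right..].
      by exists q2 => //; exact: lt_trans q'q.
    by exists q'.
  by apply: indep0 => // i /sR nu R0i; apply: nu; left.
have [hq _] := Sspec _ Sq; apply: (hq b) => // i /sR nu; apply: contra_not nu.
move=> [[?|[q' q'q iq']]|iq]; [by left|right..].
  by exists q' => //; exact: Sdown q'q.
by exists q.
Qed.

Lemma indep_recursion : exists G : bool -> set T,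
  (forall b, G0 `<=` G b /\ centered (G b)) /\
  forall q, exists i x x', [/\ G (side q) x, G (~~ side q) x' &
    (x <= w q i /\ x' <= ~` X i) \/ (x <= ~` w q i /\ x' <= X i)].
Proof.
have [||d dP] := @wf_choice Q stage lt spec lt_wf.
- by constructor; exact: (fun=> \bot, [::]).
- move=> q d d' x dd'.
  have eG b : gens d (lt^~ q) b = gens d' (lt^~ q) b.
    by congr setU; apply: eq_imagel => y yq; rewrite dd'.
  have eR : used d (lt^~ q) = used d' (lt^~ q).
    congr setU; apply/seteqP; split=> i [y yq iy]; exists y => //.
      by rewrite -dd'.
    by rewrite dd'.
  by move=> [h1 h2]; split=> // b; rewrite -eG -eR.
(* The earlier stages meet their specification, so the generators below [q] are independent modulo
   the used indices and [indep_step] applies to a fresh one. *)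
have Pd q : spec q d (d q).
  elim/(well_founded_ind lt_wf): q => q ih; apply: dP.
  have [i [nR0 iu]] := fresh (fun q => (d q).2) q.
  have [||x [r [h1 h2]]] := @indep_step (gens d (lt^~ q)) (used d (lt^~ q)) i
    (w q i) (side q).
  - apply: indep_gens => [y z yq zy|y]; [exact: lt_trans yq|exact: ih].
  - by case=> // -[y /iu/negP].
  by exists (x, r); split=> //; exists i.
exists (gens d setT); split=> [b|q].
  split; first exact: subsetUl.
  by apply: (@indep_mod_centered _ (used d setT)); exact: indep_gens.
have [_ [i hi]] := Pd q.
by exists i, ((d q).1 (side q)), ((d q).1 (~~ side q)); split=> //;
  right; exists q.
Qed.

End Independence.

(** * Antichains, consequences of a JPR-reduction, and Tukey-maximality *)

Section Antichains.
Context {disp : Order.disp_t} {T : ctbDistrLatticeType disp}.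
Hypothesis cT : @complete_BA disp T.
Implicit Types (A U V : set T).

(** Adding the complement of the join of [A], when it is nonzero, already gives maximality. *)
Lemma maximal_antichain_extension A : antichain A ->
  exists2 A', maximal_antichain A' & A `<=` A'.
Proof.
move=> [A0 Ad]; pose c := ~` bjoin A.
exists (A `|` [set x | x = c /\ c != \bot])%classic; last exact: subsetUl.
have Ac a : A a -> a `&` c = \bot.
  by move=> Aa; apply/eqP; rewrite disj_leC complK; exact: bjoin_ub.
split; first split.
- by move=> a [/A0//|[->]].
- move=> a b [Aa|[-> _]] [Ab|[-> _]] // ab; [exact: Ad|exact: Ac|].
  by rewrite meetC; exact: Ac.
move=> B [B0 Bd] AB; apply/seteqP; split=> // b Bb; apply: contrapT => nb.
have dis a : (A `|` [set x | x = c /\ c != \bot])%classic a -> a `&` b = \bot.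
  by move=> Aa; apply: Bd => [|//|e]; [exact: AB|apply: nb; rewrite -e].
have bc : b <= c.
  rewrite -disj_leC meetC; apply/eqP/bjoin_disjoint => // a Aa.
  by apply: dis; left.
have [c0|nc] := eqVneq c \bot.
  by have := B0 _ Bb; rewrite -lex0 -c0 bc.
have := B0 _ Bb; rewrite -(meet_r bc) dis ?eqxx //.
by right.
Qed.

(** [h k] is the join of the fibre over [k]; joining these over [Y] gives the join of the preimage
    of [Y], as in the first clause of [JPR_le]. *)
Lemma JPR_le_join_hom A U V : antichain A -> JPR_le U V ->
  exists h : A -> T, forall Y : set A,
    U (bjoin (\val @` Y)) <-> V (bjoin (h @` Y)).
Proof.
move=> /maximal_antichain_extension[A' mA' AA'] [g [f [fP _]]].
pose P : Part := exist _ A' mA'.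
exists (fun k => bjoin [set b | exists hb : sval (g P) b,
  sval (f P (exist _ b hb)) = \val k]) => Y.
have -> : bjoin ((fun k : A => bjoin [set b | exists hb : sval (g P) b,
    sval (f P (exist _ b hb)) = \val k]) @` Y) =
  bjoin [set b | exists hb : sval (g P) b,
    (\val @` Y) (sval (f P (exist _ b hb)))].
  apply/le_anti/andP; split; apply: bjoin_le => //.
    move=> _ [k Yk <-]; apply: bjoin_le => // b [hb e].
    by apply: bjoin_ub => //; exists hb; exists k.
  move=> b [hb [k Yk e]].
  apply: le_trans (bjoin_ub cT _); last by exists k.
  by apply: bjoin_ub => //; exists hb.
apply: (fP P) => _ [k _ <-] /=; apply: AA'; exact: set_valP.
Qed.

Lemma antichain_compl_join A (Y : set A) (k : A) : antichain A -> ~ Y k ->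
  \val k <= ~` bjoin (\val @` Y).
Proof.
move=> [_ Ad] nYk; rewrite -disj_leC meetC; apply/eqP/bjoin_disjoint => //.
move=> _ [k' Yk' <-]; apply: Ad; [exact: set_valP..|].
by move=> /val_inj kk'; apply: nYk; rewrite -kk'.
Qed.

(* Infinite subfamilies of [X] have no lower bound in a filter containing these
   elements. *)
Definition tukey_generators (X : T -> T) : set T :=
  (range X `|` [set x | exists2 E : set T, infinite_set E &
                          x = (~` bmeet (X @` E))%O])%classic.

(** For [v] in [V], only finitely many [w] in [U] satisfy [v <= X w], since otherwise [V] would
    contain the meet of infinitely many [X w] along with its complement. The meet of these [w] lies
    in [U] and is the value of [g] at [v]. *)
Lemma tukey_maximal_of_generators (X : T -> T) V :
  ultrafilter V -> tukey_generators X `<=` V -> tukey_maximal V.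
Proof.
move=> uV GV; split=> // U [fU _]; have [fV _] := uV.
have VX t : V (X t) by apply: GV; left; exists t.
have /choice[g gP] : forall v : {v | V v}, exists u : {u | U u},
    forall w, U w -> sval v <= X w -> sval u <= w.
  move=> [v Vv] /=; pose E := [set w | U w /\ v <= X w].
  have /finite_seqP[s sE] : finite_set E.
    apply: contrapT => iE; apply: (filter_proper fV (x := bmeet (X @` E))).
      have [_ [_ [_ Vup]]] := fV; apply: Vup Vv _.
      by apply: bmeet_ge => // _ [w [_ vw] <-].
    by apply: GV; right; exists E.
  have Us : U (\meet_(x <- s) x).
    apply: filter_meet => // x xs.
    have : E x by rewrite sE.
    by case.
  exists (exist _ _ Us) => w Uw vw /=; apply: meet_seq_le.
  by have : E w by []; rewrite sE.
exists (fun u => exist _ (X (sval u)) (VX (sval u))), g => u v /= vu.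
exact: gP (svalP u) vu.
Qed.

(** Let [a] collect the indices of the generators from [range X] in the list. Each infinite [E] has
    a member outside [a], whose negated literal lies below the complement of the meet over [E]. So
    signs positive exactly on [a] in the block [false] bound all generators from below. *)
Lemma indep_tukey_generators (X : T * bool -> T) :
  (forall e (s : seq (T * bool)), \meet_(i <- s) literal X e i != \bot) ->
  indep_mod X (tukey_generators (fun t => X (t, false))) [set i | i.2 = false].
Proof.
move=> h l e s lG sR.
have [a aP] : exists a : seq T, forall x, x \in l ->
    (exists2 t, t \in a & x = X (t, false)) \/
    (exists2 E : set T, infinite_set E &
       x = ~` bmeet ((fun t => X (t, false)) @` E)).
  elim: l lG => [|x l ih] lG; first by exists [::].
  have [|a aP] := ih; first by move=> y yl; apply: lG; rewrite inE yl orbT.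
  have [[t _ tx]|hx] := lG x (mem_head _ _).
    exists (t :: a) => y; rewrite inE => /orP[/eqP->|/aP].
      by left; exists t; rewrite ?mem_head.
    move=> [[t' t'a ->]|]; [left|by right].
    by exists t' => //; rewrite inE t'a orbT.
  by exists a => y; rewrite inE => /orP[/eqP->|/aP//]; right.
pose e' i := if i.2 then e i else i.1 \in a.
have /choice[i iP] : forall x, exists i : T * bool,
    x \in l -> literal X e' i <= x.
  move=> x; have [/aP|_] := boolP (x \in l); last by exists (x, true).
  move=> [[t ta ->]|[E iE ->]].
    by exists (t, false) => _; rewrite /literal /e' /= ta.
  have [t Et ta] : exists2 t, E t & t \notin a.
    apply: contrapT => /forall2NP H; apply: iE.
    apply: sub_finite_set (finite_seq a) => t Et.
    by case: (H t) => [//|/negP/negPn].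
  exists (t, false) => _; rewrite /literal /e' /= (negbTE ta) leC.
  by apply: bmeet_lb => //; exists t.
have := h e' (map i l ++ s); apply: contraNneq => e0.
rewrite -lex0 -e0 big_cat /= big_map; apply: leI2.
  apply/meetsP_seq => x xl _; apply: le_trans (iP _ xl).
  exact: (meets_inf_seq (fun x => literal X e' (i x))).
rewrite [leRHS](eq_big_seq (literal X e')) // => j js.
by move: (sR j js); rewrite /literal /e' /=; case: (j.2) => // -[].
Qed.

End Antichains.

(** * Construction of the two ultrafilters *)

Theorem mainTheorem2 (disp : Order.disp_t) (T : ctbDistrLatticeType disp) :
  @complete_BA disp T ->
  infinite_set [set: T] ->
  (exists A : set T, antichain A /\ ([set X | X `<=` A] #= [set: T])%card) ->
  exists U V : set T,
    tukey_maximal U /\ tukey_maximal V /\ ~ JPR_le U V /\ ~ JPR_le V U.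
Proof.
move=> cT /emb_nat_infinite nT [A [acA /card_esym/card_bijP[g bg]]].
pose c t : set A := [set k | \val (g (to_setT t)) (\val k)].
have gA t : \val (g (to_setT t)) `<=` A by exact: set_valP (g (to_setT t)).
have ci : injective c.
  move=> t t' e; apply: (congr1 \val (_ : to_setT t = to_setT t')).
  apply: (bij_inj bg); apply: val_inj; apply/seteqP; split=> x gx.
    have := congr1 (fun S : set A => S (SigSub (mem_set (gA _ _ gx)))) e.
    by rewrite /c /= => <-.
  have := congr1 (fun S : set A => S (SigSub (mem_set (gA _ _ gx)))) e.
  by rewrite /c /= => ->.
have Tc : emb T (set A) by exists c.
have nA := emb_nat_of_powerset nT Tc.
have cT' : emb (set A) T.
  apply: (@emb_of_rel _ _ (fun Y t => c t = Y)) => [Y|Y Y' t -> //].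
  have YA : \val @` Y `<=` A by move=> _ [k _ <-]; exact: set_valP.
  have [g' gK g'K] := bg.
  have Yin : (\val @` Y) \in [set X : set T | X `<=` A] by apply: mem_set.
  exists (\val (g' (SigSub Yin))); rewrite /c.
  rewrite (_ : to_setT _ = g' (SigSub Yin)); last exact: val_inj.
  rewrite g'K /=; apply/seteqP; split=> k /=; last by exists k.
  by move=> [k' Yk' /val_inj <-].
have [Z Zindep] := independent_family nA ci.
pose X i := bjoin (\val @` (Z i) : set T).
(* A point [k] of the corresponding combination of sets is a nonzero element below every literal. *)
have Xindep e (s : seq (T * bool)) : \meet_(i <- s) literal X e i != \bot.
  have [k kP] := Zindep e s.
  have : \val k != \bot :> T by have [h _] := acA; apply: h; exact: set_valP.
  rewrite -!lex0; apply: contraNN; apply: le_trans.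
  apply/meetsP_seq => i si _; rewrite /literal; case: ifP => ei.
    by apply: bjoin_ub => //; exists k => //; apply/kP.
  by apply: antichain_compl_join => //; rewrite kP // ei.
(* The tasks: [(b, h)] prevents [h] from coming from a reduction of [U (~~ b)] to [U b]. *)
pose Q := (bool * (A -> T))%type.
have QT : emb Q T.
  apply: emb_trans (emb_square nT); apply: emb_prod.
    by apply: emb_trans nT; exists nat_of_bool; case=> [] [].
  exact: emb_trans (emb_fun_powerset nA Tc) cT'.
have [lt iwo] := ex_initial_well_order Q.
have fresh (r : Q -> seq (T * bool)) q : exists i,
    ~ [set i | i.2 = false] i /\ forall y, lt y q -> i \notin r y.
  have [t tP] := initial_seq_not_cover (fun y => map fst (r y)) q iwo nT QT.
  exists (t, true); split=> // y /tP; apply: contra => ?.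
  by apply/mapP; exists (t, true).
have [G [GP Gq]] := @indep_recursion _ _ _ X Q lt _ _
  (fun q i => bjoin (q.2 @` Z i)) fst (iwo_wf iwo) (iwo_trans iwo) (iwo_total iwo) fresh
  (indep_tukey_generators cT Xindep).
have /choice[U UP] b : exists U, ultrafilter U /\ G b `<=` U.
  by apply: ultrafilter_of_centered; have [] := GP b.
have Umax b : tukey_maximal (U b).
  have [uU GU] := UP b; have [G0 _] := GP b.
  apply: (@tukey_maximal_of_generators _ _ cT (fun t => X (t, false))) => //.
  exact: subset_trans GU.
have nJPR b : ~ JPR_le (U (~~ b)) (U b).
  move=> /(JPR_le_join_hom cT acA)[h hP].
  have [i [x [x' [Gx Gx' xx']]]] := Gq (b, h).
  have [[fU _] GU] := UP b; have [[fU' _] GU'] := UP (~~ b).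
  have [_ [_ [_ up]]] := fU; have [_ [_ [_ up']]] := fU'.
  (* In either case [hP] at [Z i] puts an element and its complement into one ultrafilter: [X i] in
     [U (~~ b)], or the join of the image of [Z i] under [h] in [U b]. *)
  case: xx' => [[xw x'X]|[xw x'X]].
    apply: (filter_proper fU' (x := X i)); last exact: up' (GU' _ Gx') x'X.
    by apply/hP; exact: up (GU _ Gx) xw.
  apply: (filter_proper fU); last exact: up (GU _ Gx) xw.
  by apply/hP; exact: up' (GU' _ Gx') x'X.
exists (U true), (U false); split=> //; split=> //; split; first exact: (nJPR false).
exact: (nJPR true).
Qed.
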